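(* Let $n\ge 1$ and let $\lambda=(\lambda_1,\ldots,\lambda_r)$ be a partition of $n$. Write $D_m$ for the number of derangements of an $m$-element set ($D_0=1$). (i) If $\lambda_1\ge\lfloor n/2\rfloor$, then $|\eta_{(\lambda_1,1^{n-\lambda_1})}|\le|\eta_\lambda|$, and if moreover $\lambda_1\le n-1$, then $|\eta_\lambda|\le|\eta_{(\lambda_1+1,1^{n-\lambda_1-1})}|$. (ii) If $\lambda_1<\lfloor n/2\rfloor$, then $|\eta_\lambda|\le|\eta_{(\lfloor n/2\rfloor+1,\,1^{n-\lfloor n/2\rfloor-1})}|$, with strict inequality if $n\ge 6$. Moreover, for every $1\le k\le n$, $|\eta_{(k,1^{n-k})}|=D_k+(n-k)D_{k-1}$.
   Context: For $n\ge 1$, $\mathcal{D}_n\subseteq S_n$ is the set of derangements of $\{1,\ldots,n\}$ and $D_n=|\mathcal{D}_n|$, $D_0=1$. For $\lambda\vdash n$, $\chi_\lambda$ is the irreducible character of $S_n$ indexed by $\lambda$ (standard indexing, $(n)$ trivial) and $\eta_\lambda=\frac{1}{\chi_\lambda(1)}\sum_{\sigma\in\mathcal{D}_n}\chi_\lambda(\sigma)$ (the eigenvalues of the Cayley graph $\Gamma(S_n,\mathcal{D}_n)$). The notation $(k,1^{m})$ denotes the partition with one part $k$ followed by $m$ parts equal to $1$ (a hook).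
   Formalization: The second inequality of (i) is stated for λ ≠ (1,1,1) only, because it fails for n = 3, λ = (1,1,1): there |η_(1,1,1)| = 2 while |η_(2,1)| = 1. *)

(* Defs.v *)
From mathcomp Require Import all_boot all_order all_fingroup all_algebra.
From mathcomp Require Import all_solvable all_field all_character.

Set Implicit Arguments.
Unset Strict Implicit.
Unset Printing Implicit Defensive.

Import Order.TTheory GRing.Theory Num.Theory GroupScope.
Local Open Scope ring_scope.

Definition is_intpart (n : nat) (la : seq nat) : bool :=
  [&& sorted geq la, 0%N \notin la & sumn la == n].

Definition hook (k m : nat) : seq nat := k :: nseq m 1%N.

Definition derangements (n : nat) : {set 'S_n} :=
  [set s : 'S_n | [forall i, s i != i]].

(* D_0 = 1, since the identity of 'S_0 vacuously has no fixed point. *)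
Definition nder (n : nat) : nat := #|derangements n|.

(* Fill the Young diagram of la with 0, ..., n-1 along successive rows: the
   entry i then lies in row [reshape_index la i] and column
   [reshape_offset la i].  The next two sets are the row and column
   stabilisers of this tableau. *)
Definition row_stab (n : nat) (la : seq nat) : {set 'S_n} :=
  [set s : 'S_n | [forall i, reshape_index la (s i) == reshape_index la i]].

Definition col_stab (n : nat) (la : seq nat) : {set 'S_n} :=
  [set s : 'S_n | [forall i, reshape_offset la (s i) == reshape_offset la i]].

(* The Young symmetrizer, sum of sgn(q) p q over p in the row stabiliser and q
   in the column stabiliser, as a vector of the group algebra C[S_n], the
   space of [regular_repr]. *)
Definition young_sym (n : nat) (la : seq nat) : 'rV[algC]_#|[set: 'S_n]| :=
  \sum_(p in row_stab n la) \sum_(q in col_stab n la)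
    (-1) ^+ odd_perm q *:
      gring_row (regular_repr algC [set: 'S_n] (p * q)%g).

(* The Specht module: the submodule of C[S_n] generated by the Young
   symmetrizer.  MathComp modules are right modules, so this is c C[S_n]; since
   c = a b with a and b fixed by inversion, the inverse map turns it into the
   left ideal C[S_n] b a, which is isomorphic to the usual C[S_n] a b. *)
Definition specht_repr (n : nat) (la : seq nat) :=
  submod_repr (cyclic_mx_module (regular_repr algC [set: 'S_n])
                                (young_sym n la)).

Definition schar (n : nat) (la : seq nat) : 'CF([set: 'S_n]) :=
  cfRepr (specht_repr n la).

Definition eta (n : nat) (la : seq nat) : algC :=
  (schar n la 1%g)^-1 * \sum_(s in derangements n) schar n la s.

(* Main.v *)
(* Write R and C for the row and column stabilisers of the tableau. The sum of
   all derangements is central, so by von Neumann's lemma it multiplies the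
   Young symmetrizer by the sum of sgn(q) over the pairs (p, q) in R x C with
   pq fixed point free, that is with no common fixed point. By
   inclusion-exclusion this is, up to the sign (-1)^n, the sum over the sets B
   of cells with at most one cell per column of (-1)^|B| times the number of
   row-preserving permutations supported on B. Such a permutation moves a fixed
   cell of B to one of the cells of B in its row; hence, in absolute value F,
     F(la) = F(la minus its last row, of length r)
             + r F(la minus its first column),
   with F(k) = D_k for a single row. All terms are nonnegative, and the
   inequalities follow by induction on the shape: the hook minimises F for a
   given first row, while F(la) is at most its value at two-row shapes, or at
   (h, h, 1). *)

Require Import Defs.
From mathcomp Require Import all_boot all_order all_fingroup all_algebra.
From mathcomp Require Import all_solvable all_field all_character.
From mathcomp Require Import zify ring.

Set Implicit Arguments.
Unset Strict Implicit.
Unset Printing Implicit Defensive.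

Import Order.TTheory GRing.Theory Num.Theory.
Local Open Scope ring_scope.

(** * Von Neumann's lemma *)

Section FiberPerms.

Variables (T : finType) (f : T -> nat).

(** With [f] the row or the column index of a cell, this is the row or the column stabiliser. *)
Definition fiber_perms : {set {perm T}} :=
  [set s : {perm T} | [forall i, f (s i) == f i]].

Lemma fiber_permsP (s : {perm T}) :
  reflect (forall i, f (s i) = f i) (s \in fiber_perms).
Proof. by rewrite inE; apply: eqfunP. Qed.

Lemma fiber_perms_group_set : group_set fiber_perms.
Proof.
apply/group_setP; split=> [|s t]; first by apply/fiber_permsP => i; rewrite perm1.
move=> /fiber_permsP fs /fiber_permsP ft.
by apply/fiber_permsP => i; rewrite permM ft.
Qed.
Canonical fiber_perms_group := Group fiber_perms_group_set.

Lemma tperm_fiber i j : f i = f j -> tperm i j \in fiber_perms.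
Proof.
by move=> fij; apply/fiber_permsP => k; case: tpermP => [->|->|]; rewrite ?fij.
Qed.

End FiberPerms.

Section Tableau.

Variables (T : finType) (la : seq nat) (row col : T -> nat).

Hypothesis cell_inj : forall i j, row i = row j -> col i = col j -> i = j.
Hypothesis row_lt : forall i, (row i < size la)%N.
Hypothesis col_lt : forall i, (col i < nth 0%N la (row i))%N.
Hypothesis cell_ex : forall r c,
  (c < nth 0%N la r)%N -> exists i, row i = r /\ col i = c.

Local Notation rowst := (fiber_perms row).
Local Notation colst := (fiber_perms col).

(* Compare, row by row, the cells sent by x into the first t columns with the
   cells lying there: both families have the same total, and the former is at
   most min(t, la_s) in row s. *)
Lemma injective_on_rows_col_lt (x : {perm T}) :
    (forall i j, row i = row j -> col (x i) = col (x j) -> i = j) ->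
  forall i, (col (x i) < nth 0%N la (row i))%N.
Proof.
move=> x_inj i; set r := row i; set t := nth 0%N la r.
pose A := [set j | (col (x j) < t)%N]; pose B := [set j | (col j < t)%N].
pose E (X : {set T}) (s : 'I_(size la)) := #|X :&: [set j | row j == s]|.
have sumE X : (\sum_s E X s)%N = #|X|.
  rewrite -sum1_card (partition_big (fun j => Ordinal (row_lt j)) xpredT) //=.
  apply: eq_bigr => s _; rewrite /E -sum1_card; apply: eq_bigl => j.
  by rewrite !inE -val_eqE.
have cardAB : #|A| = #|B|.
  rewrite -(card_imset A (@perm_inj _ x)); congr #|pred_of_set _|; apply/setP=> j.
  by rewrite -{1}(permKV x j) mem_imset ?inE ?permKV //; apply: perm_inj.
have leAB s : (E A s <= E B s)%N.
  have [le_t | lt_t] := leqP (nth 0%N la s) t.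
    apply/subset_leq_card/subsetP=> j; rewrite !inE => /andP[_ /eqP rj].
    by rewrite rj eqxx (leq_trans (col_lt j)) ?rj.
  apply: (@leq_trans t).
    case: (posnP t) => [t0|t_gt0].
      rewrite /E /A t0; rewrite (_ : _ :&: _ = set0) ?cards0 //.
      by apply/setP=> j; rewrite !inE ltn0.
    rewrite /E -(@card_in_imset _ _ (fun j => inord (col (x j)) : 'I_t.-1.+1)).
      by rewrite (leq_trans (max_card _)) // !card_ord prednK.
    move=> j k; rewrite !inE => /andP[cj /eqP rj] /andP[ck /eqP rk] /(congr1 val).
    rewrite /= !inordK ?prednK // => eq_c.
    by apply: x_inj; rewrite ?rj ?rk.
  have ex (c : 'I_t) : exists j, (row j == s) && (col j == c).
    have [j [rj cj]] := cell_ex (ltn_trans (ltn_ord c) lt_t).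
    by exists j; rewrite rj cj !eqxx.
  rewrite -{1}(card_ord t) -(@card_imset _ _ (fun c => xchoose (ex c))).
    apply/subset_leq_card/subsetP=> _ /imsetP[c _ ->]; rewrite !inE.
    by have /andP[-> /eqP->] := xchooseP (ex c); rewrite ltn_ord.
  move=> c d eq_cd; apply: val_inj => /=.
  have /andP[_ /eqP<-] := xchooseP (ex c); rewrite eq_cd.
  by have /andP[_ /eqP] := xchooseP (ex d).
(* The totals over all rows agree, so equality holds in every row. All cells of row [r] lie in the
   first [t] columns, hence [x] sends all of them there. *)
have leif s (_ : true) : (E A s <= E B s ?= iff (E A s == E B s))%N by split.
have [_] := leqif_sum leif; rewrite !sumE cardAB eqxx => /esym/forallP/(_ (Ordinal (row_lt i))).
move=> /eqP eqE.
have sub : A :&: [set j | row j == r] \subset [set j | row j == r] by apply: subsetIr.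
have BE : B :&: [set j | row j == r] = [set j | row j == r].
  apply/setP=> j; rewrite !inE andbC; case: (eqVneq (row j) r) => //= rj.
  by rewrite /t -rj col_lt.
have : A :&: [set j | row j == r] == [set j | row j == r].
  by rewrite eqEcard sub /=; move: eqE; rewrite /E /= BE => ->.
by move/eqP/setP/(_ i); rewrite !inE eqxx andbT.
Qed.

(** Move each cell along its row to the column where [x] sends it. The previous lemma provides the
    target cell, and what remains of [x] preserves columns. *)
Lemma rowst_colst_factor (x : {perm T}) :
    (forall i j, row i = row j -> col (x i) = col (x j) -> i = j) ->
  exists2 p, p \in rowst & (p^-1 * x)%g \in colst.
Proof.
move=> x_inj.
have ex i : exists j, (row j == row i) && (col j == col (x i)).
  have [j [rj cj]] := cell_ex (injective_on_rows_col_lt x_inj i).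
  by exists j; rewrite rj cj !eqxx.
pose g i := xchoose (ex i).
have gP i : row (g i) = row i /\ col (g i) = col (x i).
  by have /andP[/eqP-> /eqP->] := xchooseP (ex i).
have g_inj : injective g.
  move=> i j eq_g; have [ri ci] := gP i; have [rj cj] := gP j.
  by apply: x_inj; rewrite -?ri -?rj -?ci -?cj eq_g.
exists (perm g_inj); first by apply/fiber_permsP => i; rewrite permE; case: (gP i).
apply/fiber_permsP => i; rewrite permM -{2}(permKV (perm g_inj) i).
by rewrite [in RHS]permE; case: (gP ((perm g_inj)^-1 i)%g).
Qed.

Lemma rowst_colst1 (p : {perm T}) : p \in rowst -> p \in colst -> p = 1%g.
Proof.
move=> /fiber_permsP rp /fiber_permsP cp.
by apply/permP=> i; rewrite perm1; apply: cell_inj.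
Qed.

Section SignedCount.

Variables (R : numDomainType) (D : {set {perm T}}).

(** For [D] stable under conjugation, this is the coefficient of [x] in the product of the Young
    symmetrizer and the sum of [D]. *)
Definition signed_count (x : {perm T}) : R :=
  \sum_(p in rowst) \sum_(q in colst) (-1) ^+ odd_perm q * (p * x * q \in D)%g%:R.

Lemma signed_countMl p x : p \in rowst -> signed_count (p * x)%g = signed_count x.
Proof.
move=> Rp; rewrite /signed_count [RHS](reindex_inj (mulIg p)) /=.
apply: eq_big => [s|s _]; first by rewrite groupMr.
by under eq_bigr do rewrite mulgA.
Qed.

Lemma signed_countMr x q : q \in colst ->
  signed_count (x * q)%g = (-1) ^+ odd_perm q * signed_count x.
Proof.
move=> Cq; rewrite /signed_count mulr_sumr; apply: eq_bigr => p _.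
rewrite [X in _ * X](reindex_inj (mulgI q)) /= mulr_sumr.
apply: eq_big => [s|s _]; first by rewrite groupMl.
by rewrite odd_permM mulrA signr_addb mulrA -expr2 sqrr_sign mul1r !mulgA.
Qed.

(* Von Neumann's lemma *)
Lemma signed_count_eq0 x :
  ~~ [exists p in rowst, p^-1 * x \in colst]%g -> signed_count x = 0.
Proof.
move=> notRC.
(* If [x] sends two cells of one row into one column, their transposition is in the row stabiliser
   and its conjugate by [x] in the column stabiliser, so [signed_count x] equals its opposite.
   Otherwise [rowst_colst_factor] applies. *)
have [i /existsP[j]|inj] := pickP (fun i => [exists j, [&& row i == row j,
    col (x i) == col (x j) & i != j]]).
  move=> /and3P[/eqP rij /eqP cij ne_ij].
  have := signed_countMl x (tperm_fiber rij).
  have -> : (tperm i j * x)%g = (x * tperm (x i) (x j))%g.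
    by rewrite -tpermJ conjgE !mulgA mulgV mul1g.
  rewrite signed_countMr ?tperm_fiber // odd_tperm (inj_eq perm_inj) ne_ij expr1.
  rewrite mulN1r => /eqP; rewrite eq_sym -addr_eq0 -mulr2n mulrn_eq0 /=.
  by move/eqP.
case/existsP: notRC; case: (@rowst_colst_factor x) => [i j rij cij | p Rp Cq].
  apply/eqP; apply: contraFT (inj i) => ne_ij; apply/existsP; exists j.
  by rewrite rij cij ne_ij !eqxx.
by exists p; rewrite Rp.
Qed.

End SignedCount.

(** If [p * q] fixes [i], then [p i] lies in the row of [i] and, being sent to [i] by [q], also in
    its column; hence [p i = i]. *)
Lemma fixfree_mul (p q : {perm T}) : p \in rowst -> q \in colst ->
  [forall i, (p * q)%g i != i] = [forall i, ~~ ((p i == i) && (q i == i))].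
Proof.
move=> /fiber_permsP rp /fiber_permsP cq; apply: eq_forallb => i; congr (~~ _).
rewrite permM; apply/eqP/andP=> [qpi | [/eqP-> /eqP//]].
have pi : p i = i by apply: cell_inj; rewrite // -{2}qpi cq.
by rewrite -{3}pi qpi pi.
Qed.

End Tableau.

(** * Inclusion-exclusion *)

Lemma sum_signr_subset (R : numDomainType) (T : finType) (S : {set T}) :
  \sum_(A : {set T} | A \subset S) (-1) ^+ #|A| = (S == set0)%:R :> R.
Proof.
have [->|[x Sx]] := set_0Vmem S.
  rewrite eqxx (big_pred1 set0) ?cards0 // => A.
  by rewrite subset0.
rewrite [S == _](negPf _); last by apply/set0Pn; exists x.
(* Toggling [x] is a sign-reversing involution on the subsets of [S]. *)
pose h (A : {set T}) := if x \in A then A :\ x else x |: A.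
have hK : involutive h.
  move=> A; rewrite /h; case: (boolP (x \in A)) => xA; first by rewrite setD11 setD1K.
  by rewrite setU11 setU1K.
set s := LHS; suff: s = - s by move/eqP; rewrite -addr_eq0 -mulr2n mulrn_eq0 => /eqP.
rewrite {1}/s (reindex_inj (inv_inj hK)) /= -sumrN; apply: eq_big => A.
  rewrite /h; case: ifP => xA; last by rewrite subUset sub1set Sx.
  by rewrite -{2}(setD1K xA) subUset sub1set Sx.
rewrite /h; case: ifP => xA _; last by rewrite cardsU1 xA exprS mulN1r.
by rewrite [in RHS](cardsD1 x A) xA exprS mulN1r opprK.
Qed.

Section RowPerms.

Variables (T : finType) (row col : T -> nat).

Definition row_perms (B : {set T}) : {set {perm T}} :=
  [set p in fiber_perms row | perm_on B p].

Lemma in_row_perms (B : {set T}) p :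
  (p \in row_perms B) = (p \in fiber_perms row) && perm_on B p.
Proof. by rewrite in_set. Qed.

Definition transversal_cols (B : {set T}) :=
  [forall i in B, forall j in B, (col i == col j) ==> (i == j)].

Lemma transversal_colsP (B : {set T}) :
  reflect {in B &, injective col} (transversal_cols B).
Proof.
apply: (iffP forall_inP) => [H i j iB jB /eqP cij | H i iB].
  by have /forall_inP/(_ j jB)/implyP/(_ cij)/eqP := H i iB.
by apply/forall_inP=> j jB; apply/implyP => /eqP/H->.
Qed.

Lemma perm_onP (B : {set T}) (p : {perm T}) :
  reflect (forall i, i \notin B -> p i = i) (perm_on B p).
Proof.
apply: (iffP idP) => [pB i iB | H]; first exact: out_perm pB iB.
by apply/subsetP=> i; apply: contraR => /H ->.
Qed.

Lemma row_perms0 : row_perms set0 = [set 1%g].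
Proof.
apply/setP=> p; rewrite !inE; apply/andP/eqP=> [[_ /perm_onP p1] | ->].
  by apply/permP=> i; rewrite p1 ?inE // perm1.
by split; [apply/forallP=> i; rewrite perm1 | apply: perm_on1].
Qed.

(* Composing with the transposition (x y) turns the permutations mapping x to y
   into those fixing x. *)
Lemma card_row_permsD1 (B : {set T}) x : x \in B ->
  #|row_perms B| = (#|[set y in B | row y == row x]| * #|row_perms (B :\ x)|)%N.
Proof.
move=> xB; rewrite -sum1_card.
rewrite (partition_big (fun p : {perm T} => p x)
  (fun y => y \in [set y in B | row y == row x])) /=; last first.
  move=> p; rewrite !inE => /andP[/forallP/(_ x)/eqP-> pB].
  by rewrite eqxx andbT (perm_closed _ pB).
rewrite -sum_nat_const; apply: eq_bigr => y; rewrite inE => /andP[yB /eqP ryx].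
rewrite sum1_card -(card_imset _ (mulIg (tperm x y))); congr #|pred_of_set _|.
have onB : perm_on B (tperm x y).
  by apply: subset_trans (tperm_on x y) _; rewrite subUset !sub1set xB.
apply/setP=> p; apply/imsetP/idP => [[s] | ].
  rewrite unfold_in /= in_row_perms => /andP[/andP[sR sB] /eqP sx] ->.
  rewrite in_row_perms groupM ?tperm_fiber //=.
  apply/perm_onP=> i; rewrite !inE negb_and negbK.
  case/orP => [/eqP-> | iB]; first by rewrite permM sx tpermR.
  by rewrite (out_perm _ iB) // perm_onM.
rewrite in_row_perms => /andP[pR /perm_onP pB].
exists (p * tperm x y)%g; last by rewrite -mulgA tperm2 mulg1.
have px : p x = x by rewrite pB // !inE eqxx.
rewrite unfold_in /= in_row_perms permM px tpermL eqxx andbT.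
rewrite groupM ?tperm_fiber //=.
by rewrite perm_onM //; apply/perm_onP=> i iB; rewrite pB // !inE (negPf iB) andbF.
Qed.

(** If [B] has m cells in row [a], each of the m summands is the m-th part of the right side by
    [card_row_permsD1]. *)
Lemma sum_card_row_permsD1 (B : {set T}) a : [set x in B | row x == a] != set0 ->
  (\sum_(x in B | row x == a) #|row_perms (B :\ x)| = #|row_perms B|)%N.
Proof.
move=> Ba_n0; set Ba := [set x in B | row x == a] in Ba_n0 *.
have Ba_gt0 : (0 < #|Ba|)%N by rewrite card_gt0.
apply/eqP; rewrite -(eqn_pmul2l Ba_gt0) big_distrr -sum_nat_const /=; apply/eqP.
apply: eq_big => [x | x /andP[xB /eqP rx]]; first by rewrite inE.
by rewrite (card_row_permsD1 xB) rx.
Qed.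

Variable R : numDomainType.

Definition transversal_sum (X : {set T}) : R :=
  \sum_(B : {set T} | (B \subset X) && transversal_cols B)
    (-1) ^+ #|B| * #|row_perms B|%:R.

Lemma transversal_sum0 : transversal_sum set0 = 1.
Proof.
rewrite /transversal_sum (big_pred1 set0) => [|B].
  by rewrite cards0 row_perms0 cards1 mul1r.
rewrite subset0 andb_idr // => /eqP ->.
by apply/transversal_colsP => i; rewrite inE.
Qed.

(** Sets [B] that miss row [a] give the first term. For the others [sum_card_row_permsD1] spreads
    the weight over the cells [x] of [B] in row [a]; then [B :\ x] is a transversal set avoiding the
    column of [x], with the opposite sign. *)
Lemma transversal_sum_rec (X : {set T}) a :
  transversal_sum X = transversal_sum [set i in X | row i != a]
    - \sum_(x in X | row x == a) transversal_sum [set i in X | col i != col x].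
Proof.
rewrite {1}/transversal_sum (bigID (fun B : {set T} => [set x in B | row x == a] == set0)) /=.
congr (_ + _).
  apply: eq_bigl => B; rewrite andbAC; congr (_ && _).
  apply/andP/subsetP => [[/subsetP BX /eqP/setP B0] i iB | H].
    by rewrite inE BX //=; have := B0 i; rewrite !inE iB => /= ->.
  split; first by apply/subsetP=> i /H; rewrite inE => /andP[].
  apply/eqP/setP=> i; rewrite !inE; apply/andP => -[/H].
  by rewrite inE => /andP[_ /negPf->].
transitivity (\sum_(B : {set T} | (B \subset X) && transversal_cols B)
   \sum_(x in B | row x == a) (-1) ^+ #|B| * #|row_perms (B :\ x)|%:R : R).
  rewrite [RHS](bigID (fun B : {set T} => [set x in B | row x == a] == set0)) /=.
  rewrite [X in _ = X + _]big1 ?add0r => [|B /andP[_ /eqP/setP B0]].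
    apply: eq_bigr => B /andP[_ Ba]; rewrite -mulr_sumr -natr_sum.
    by rewrite sum_card_row_permsD1.
  by rewrite big1 // => x; have := B0 x; rewrite !inE => ->.
rewrite (exchange_big_dep (fun x => (x \in X) && (row x == a))) /=; last first.
  by move=> B x /andP[/subsetP BX _] /andP[/BX-> ->].
rewrite -sumrN; apply: eq_bigr => x /andP[xX rx].
rewrite (reindex_onto (fun B => x |: B) (fun B => B :\ x)) /=; last first.
  by move=> B /andP[_ /andP[xB _]]; rewrite setD1K.
rewrite -sumrN; apply: eq_big => [B | B].
  rewrite setU11 rx !andbT; apply/andP/andP => [[/andP[]] | [/subsetP BX trB]].
    rewrite subUset sub1set xX /= => /subsetP BX /transversal_colsP tr /eqP xB.
    have x_nB : x \notin B by rewrite -xB setD11.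
    split; last first.
      by apply/transversal_colsP=> i j iB jB; apply: tr; rewrite setU1r.
    apply/subsetP=> i iB; rewrite inE BX //=; apply: contraNneq x_nB => cix.
    by rewrite -(tr i x) ?setU11 ?setU1r.
  have x_nB : x \notin B by apply/negP => /BX; rewrite inE eqxx andbF.
  rewrite setU1K // eqxx subUset sub1set xX /=; split=> //; apply/andP; split.
    by apply/subsetP=> i /BX; rewrite inE => /andP[].
  have colBx i : i \in B -> col i != col x by move=> /BX; rewrite inE => /andP[].
  apply/transversal_colsP=> i j; rewrite !inE.
  case/predU1P=> [->|iB] /predU1P[->|jB] //.
  - by move/esym/eqP; rewrite (negPf (colBx j jB)).
  - by move/eqP; rewrite (negPf (colBx i iB)).
  exact: (transversal_colsP _ trB).
move=> /andP[_ /eqP xB]; have x_nB : x \notin B by rewrite -xB setD11.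
by rewrite setU1K // cardsU1 x_nB exprS mulN1r mulNr.
Qed.

(** Two cells of [B] in the same column give a transposition that pairs off permutations of opposite
    sign; without such cells only the identity is left. *)
Lemma sum_sign_col_perms (B : {set T}) :
  \sum_(q in fiber_perms col | perm_on B q) (-1) ^+ odd_perm q
    = (transversal_cols B)%:R :> R.
Proof.
have [/transversal_colsP trB | ntrB] := boolP (transversal_cols B).
  rewrite (big_pred1 1%g) ?odd_perm1 // => q; apply/andP/eqP => [[] | ->].
    move=> /fiber_permsP cq qB; apply/permP=> i; rewrite perm1.
    have [iB|iB] := boolP (i \in B); last exact: out_perm qB iB.
    by apply: trB; rewrite ?perm_closed.
  by rewrite group1 perm_on1.
have [i iB [j jB [cij ne_ij]]] :
    exists2 i, i \in B & exists2 j, j \in B & col i = col j /\ i != j.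
  move: ntrB; rewrite negb_forall => /existsP[i]; rewrite negb_imply.
  case/andP=> iB; rewrite negb_forall => /existsP[j]; rewrite !negb_imply.
  by case/and3P=> jB /eqP cij ne_ij; exists i => //; exists j.
have tB : perm_on B (tperm i j).
  by apply: subset_trans (tperm_on i j) _; rewrite subUset !sub1set iB.
set s := LHS; suff: s = - s by move/eqP; rewrite -addr_eq0 -mulr2n mulrn_eq0 => /eqP.
rewrite {1}/s (reindex_inj (mulgI (tperm i j))) -sumrN /=; apply: eq_big => q.
  rewrite groupMl ?tperm_fiber //; congr (_ && _); apply/idP/idP=> [tqB | qB].
    by rewrite -[q](tpermKg i j) perm_onM.
  exact: perm_onM.
by rewrite odd_permM odd_tperm ne_ij signr_addb expr1 mulN1r.
Qed.

(* Inclusion-exclusion on the set ~: B of common fixed points. *)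
Lemma sum_no_common_fix :
  \sum_(p in fiber_perms row) \sum_(q in fiber_perms col)
     (-1) ^+ odd_perm q * [forall i, ~~ ((p i == i) && (q i == i))]%:R
  = (-1) ^+ #|T| * transversal_sum setT :> R.
Proof.
pose fx (p : {perm T}) := [set i | p i == i].
transitivity (\sum_(p in fiber_perms row) \sum_(q in fiber_perms col)
    \sum_(A : {set T} | A \subset fx p :&: fx q)
      (-1) ^+ odd_perm q * (-1) ^+ #|A| : R).
  apply: eq_bigr => p _; apply: eq_bigr => q _; rewrite -mulr_sumr.
  rewrite sum_signr_subset; congr (_ * (nat_of_bool _)%:R).
  apply/forallP/eqP => [H | /setP H i]; last by have := H i; rewrite !inE => ->.
  by apply/setP=> i; rewrite !inE; have := H i; move/negPf.
have onC (p : {perm T}) (B : {set T}) : (~: B \subset fx p) = perm_on B p.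
  apply/subsetP/perm_onP=> H i; first by move=> iB; apply/eqP; have := H i; rewrite !inE; apply.
  by rewrite !inE => /H ->.
transitivity (\sum_(A : {set T}) \sum_(p in fiber_perms row | A \subset fx p)
    \sum_(q in fiber_perms col | A \subset fx q)
      (-1) ^+ odd_perm q * (-1) ^+ #|A| : R).
  under eq_bigr => p _ do rewrite (exchange_big_dep xpredT) //=.
  rewrite exchange_big; apply: eq_bigr => A _ /=; rewrite big_mkcondr.
  apply: eq_bigr => p _; case: ifP => pA; last first.
    by rewrite big1 // => q; rewrite subsetI pA andbF.
  by apply: eq_bigl => q; rewrite subsetI pA.
rewrite (reindex_inj (inv_inj (@setCK T))) /= /transversal_sum mulr_sumr.
rewrite [RHS](eq_bigl (fun B => true && transversal_cols B)); last first.
  by move=> B; rewrite subsetT.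
rewrite [RHS]big_mkcondr /=; apply: eq_bigr => B _.
transitivity (\sum_(p in row_perms B) (transversal_cols B)%:R * (-1) ^+ #|~: B| : R).
  apply: eq_big => [p | p _]; first by rewrite in_row_perms onC.
  by rewrite -mulr_suml -sum_sign_col_perms; under eq_bigl do rewrite onC.
rewrite sumr_const -[_ *+ #|row_perms B|]mulr_natr.
case: (transversal_cols B); last by rewrite !mul0r.
rewrite mul1r mulrA; congr (_ * _).
by rewrite -signr_odd cardsCs setCK oddB ?max_card // signr_addb !signr_odd.
Qed.

End RowPerms.

(** * Recurrence in the shape *)

Fixpoint dernum (k : nat) : nat :=
  if k is k'.+1 then
    if k' is k''.+1 then (k' * (dernum k' + dernum k''))%N else 0%N
  else 1%N.

Lemma dernumSS k : dernum k.+2 = (k.+1 * (dernum k.+1 + dernum k))%N.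
Proof. by []. Qed.

Lemma dernumS_sign (R : comPzRingType) k :
  (dernum k.+1)%:R = k.+1%:R * (dernum k)%:R + (-1) ^+ k.+1 :> R.
Proof.
elim: k => [|k IHk]; first by rewrite mul1r expr1 subrr.
have /esym/(canRL (addKr _)) sgnE := IHk.
by rewrite exprS sgnE dernumSS natrM natrD -(addn1 k.+1) [in RHS]natrD; ring.
Qed.

(** The recurrence for the shape, unrolled along a last row of length [r]: either that row is
    dropped, leaving [f d], or a column is, with factor [r]. Counting removed columns in [d] leaves
    the list alone and keeps the recursion structural. *)
Fixpoint removal_step (f : nat -> nat) (r d : nat) : nat :=
  (f d + if r is r'.+1 then r * removal_step f r' d.+1 else 0)%N.

(* [s] lists the row lengths from bottom to top, and [d] is the number of
   full columns already removed. *)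
Fixpoint removal_count (s : seq nat) : nat -> nat :=
  match s with
  | [::] => fun=> 1%N
  | r :: s' => if s' is [::] then fun d => dernum (r - d)
               else fun d => removal_step (removal_count s') (r - d) d
  end.

Definition abs_eta (s : seq nat) : nat := removal_count s 0.

Lemma removal_count_shift s d :
  removal_count s d.+1 = removal_count (map predn s) d.
Proof.
elim: s d => [|r [|r2 s] IHs] // d.
  by rewrite /= -subn1 -subnDA add1n.
have -> : removal_count (r :: r2 :: s) d.+1
  = removal_step (removal_count (r2 :: s)) (r - d.+1) d.+1 by [].
have -> : removal_count (map predn (r :: r2 :: s)) d
  = removal_step (removal_count (map predn (r2 :: s))) (r.-1 - d) d by [].
rewrite -subn1 -subnDA add1n.
move: (removal_count (r2 :: s)) (removal_count (map predn _)) IHs => f g fg.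
by move: (r - d.+1)%N => m; elim: m d => [|m IHm] d /=; rewrite fg // IHm.
Qed.

Lemma abs_eta_row r : abs_eta [:: r] = dernum r.
Proof. by rewrite /abs_eta /= subn0. Qed.

Lemma abs_eta_rec r s : s != [::] ->
  abs_eta (r :: s) = (abs_eta s + r * abs_eta (map predn (r :: s)))%N.
Proof.
case: s => // r2 s _; rewrite {3}/abs_eta -removal_count_shift.
by case: r => [|r]; rewrite /abs_eta /= ?subn0 ?subn1.
Qed.

(** * The transversal sum in terms of row lengths *)

Section RowLengths.

Variables (T : finType) (row col : T -> nat).

Hypothesis cell_inj : forall i j, row i = row j -> col i = col j -> i = j.

Implicit Types X : {set T}.

Definition row_length (X : {set T}) b := #|[set i in X | row i == b]|.

Definition row_lengths (X : {set T}) a :=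
  [seq row_length X b | b <- rev (iota 0 a)].

Lemma row_lengthsS X a :
  row_lengths X a.+1 = row_length X a :: row_lengths X a.
Proof. by rewrite /row_lengths -addn1 iotaD rev_cat. Qed.

(** The recurrence deletes the column of any cell of the last row, not only the first column, so a
    set of cells does not stay left-justified. That columns have no gaps towards row 0 does survive,
    and row lengths then determine the sum. *)
Definition top_closed (X : {set T}) :=
  forall i b, i \in X -> (b <= row i)%N ->
    exists j, [/\ j \in X, row j = b & col j = col i].

Local Notation del_col X x := [set i in X | col i != col x].
Local Notation del_row X a := [set i in X | row i != a].

Lemma top_closed_del_col X x : top_closed X -> top_closed (del_col X x).
Proof.
move=> tcX i b; rewrite inE => /andP[iX cix] le_b.
by have [j [jX rj cj]] := tcX i b iX le_b; exists j; rewrite inE jX cj.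
Qed.

Lemma top_closed_del_row X a :
  top_closed X -> (forall i, i \in X -> (row i <= a)%N) -> top_closed (del_row X a).
Proof.
move=> tcX le_a i b; rewrite inE => /andP[iX ria] le_b.
have [j [jX rj cj]] := tcX i b iX le_b; exists j; rewrite inE jX rj; split=> //=.
have := le_a i iX; lia.
Qed.

(** The column of [x] meets each row from 0 to [row x] in exactly one cell: one exists by closure,
    and [cell_inj] makes it unique. *)
Lemma row_length_del_col X x b : top_closed X -> x \in X -> (b <= row x)%N ->
  row_length X b = (row_length (del_col X x) b).+1.
Proof.
move=> tcX xX le_b; have [y [yX ry cy]] := tcX x b xX le_b.
rewrite /row_length (cardsD1 y) inE yX ry eqxx; congr _.+1.
congr #|pred_of_set _|; apply/setP=> i; rewrite !inE -andbA.
case: (boolP (i \in X)) => [iX|]; last by rewrite andbF.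
case: (eqVneq (row i) b) => [ri|]; last by rewrite !andbF.
rewrite !andbT /= -cy; congr (~~ _); apply/eqP/eqP=> [->//|cij].
by apply: cell_inj; rewrite // ri.
Qed.

Lemma row_length_del_row X a b : b != a ->
  row_length (del_row X a) b = row_length X b.
Proof.
move=> ne_ba; congr #|pred_of_set _|; apply/setP=> i; rewrite !inE -andbA.
by case: (eqVneq (row i) b) => [->|]; rewrite ?ne_ba ?andbF.
Qed.

Variable R : numDomainType.
Local Notation tsum := (transversal_sum row col R).

(** Deleting the row leaves the empty set and deleting a column leaves a shorter row, so
    [transversal_sum_rec] becomes the one-term recurrence [dernumS_sign]. *)
Lemma transversal_sum_row X : (forall i, i \in X -> row i = 0%N) ->
  tsum X = (-1) ^+ #|X| * (dernum #|X|)%:R.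
Proof.
move: {2}#|X| (erefl #|X|) => m; elim: m X => [|m IHm] X cX row0.
  by rewrite (cards0_eq cX) transversal_sum0 cards0 mul1r.
have tcX : top_closed X.
  by move=> i b iX; rewrite row0 // leqn0 => /eqP->; exists i; rewrite row0.
have rX : [set i in X | row i == 0%N] = X.
  by apply/setP=> i; rewrite inE andb_idr // => /row0->.
rewrite (transversal_sum_rec _ _ _ X 0%N).
rewrite (_ : del_row X 0%N = set0) ?transversal_sum0; last first.
  by apply/setP=> i; rewrite !inE; apply/andP => -[/row0->].
rewrite (eq_bigr (fun=> (-1) ^+ m * (dernum m)%:R)) => [|x /andP[xX _]]; last first.
  have cX' : #|del_col X x| = m.
    have := row_length_del_col (b := 0%N) tcX xX isT; rewrite /row_length rX cX.
    rewrite (_ : [set i in del_col X x | _] = del_col X x) => [[]//|].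
    by apply/setP=> i; rewrite !inE andb_idr // => /andP[/row0->].
  by rewrite -{1}cX' -cX'; apply: IHm => // i; rewrite inE => /andP[/row0].
rewrite (eq_bigl (fun x => x \in X)); last by move=> i; rewrite andb_idr // => /row0->.
rewrite sumr_const cX dernumS_sign -[_ *+ m.+1]mulr_natl exprS.
by have sgn2 := @sqrr_sign R m; rewrite expr2 in sgn2; ring: sgn2.
Qed.

(** Deleting the last row keeps row 0 and the sign. Deleting a column shortens row 0 by one, and
    this sign change cancels the minus in [transversal_sum_rec], so all terms add up. *)
Lemma transversal_sumE X a : top_closed X -> (forall i, i \in X -> (row i <= a)%N) ->
  tsum X = (-1) ^+ row_length X 0%N * (abs_eta (row_lengths X a.+1))%:R.
Proof.
(* Row [a] may be empty, and deleting it then leaves [X] as it is; hence [a] is part of the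
   measure. *)
move: {2}(#|X| + a)%N (leqnn (#|X| + a)) => m.
elim: m X a => [|m IHm] X a le_m tcX le_a.
  move: le_m; rewrite leqn0 addn_eq0 => /andP[/eqP cX /eqP->].
  have -> : X = set0 by apply: cards0_eq.
  rewrite transversal_sum0 row_lengthsS abs_eta_row /row_length.
  rewrite (_ : [set i in set0 | _] = set0) ?cards0 ?mulr1 //.
  by apply/setP=> i; rewrite !inE.
case: a le_m le_a => [|a] le_m le_a.
  have row0 i : i \in X -> row i = 0%N by move/le_a; rewrite leqn0 => /eqP.
  rewrite transversal_sum_row // row_lengthsS abs_eta_row /row_length.
  by rewrite (_ : [set i in X | _] = X) //; apply/setP=> i; rewrite inE andb_idr // => /row0->.
rewrite (transversal_sum_rec _ _ _ X a.+1) row_lengthsS abs_eta_rec ?row_lengthsS //.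
rewrite -row_lengthsS.
have IHrow : tsum (del_row X a.+1)
    = (-1) ^+ row_length X 0%N * (abs_eta (row_lengths X a.+1))%:R.
  rewrite (IHm _ a).
  - rewrite row_length_del_row //; congr (_ * (abs_eta _)%:R).
    apply/eq_in_map => b; rewrite mem_rev mem_iota => /andP[_ lt_b].
    by rewrite row_length_del_row //; lia.
  - have : (#|del_row X a.+1| <= #|X|)%N.
      by apply/subset_leq_card/subsetP=> i; rewrite inE => /andP[].
    lia.
  - exact: top_closed_del_row.
  by move=> i; rewrite inE => /andP[/le_a]; lia.
have IHcol x : x \in X -> row x == a.+1 -> tsum (del_col X x)
    = - ((-1) ^+ row_length X 0%N * (abs_eta (map predn (row_lengths X a.+2)))%:R).
  move=> xX /eqP rx; rewrite (IHm _ a.+1).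
  - rewrite (row_length_del_col tcX xX) // exprS mulN1r mulNr opprK.
    congr (_ * (abs_eta _)%:R); rewrite -map_comp; apply/eq_in_map => b.
    rewrite mem_rev mem_iota => /andP[_ lt_b] /=.
    by rewrite [in RHS](row_length_del_col tcX xX) ?rx.
  - have : (#|del_col X x| < #|X|)%N.
      apply/proper_card/properP; split; first by apply/subsetP=> i; rewrite inE => /andP[].
      by exists x => //; rewrite inE eqxx andbF.
    lia.
  - exact: top_closed_del_col.
  by move=> i; rewrite inE => /andP[/le_a].
rewrite IHrow (eq_bigr (fun=> - ((-1) ^+ row_length X 0
    * (abs_eta (map predn (row_lengths X a.+2)))%:R))); last first.
  by move=> x /andP[]; exact: IHcol.
rewrite (eq_bigl (fun x => x \in [set i in X | row i == a.+1])); last by move=> i; rewrite inE.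
rewrite sumr_const -/(row_length X a.+1) mulNrn opprK natrD natrM mulrDr.
by congr (_ + _); rewrite (row_lengthsS _ a.+1) -[LHS]mulr_natl mulrCA.
Qed.

End RowLengths.

(** Apply inclusion-exclusion to a single row: every permutation preserves it, and only the identity
    preserves its columns. *)
Lemma nderE n : nder n = dernum n.
Proof.
pose row (_ : 'I_n) := 0%N; pose col (i : 'I_n) := i : nat.
have cell_inj i j : row i = row j -> col i = col j -> i = j by move=> _; apply: val_inj.
have rowT : fiber_perms row = setT.
  by apply/setP=> p; rewrite !inE; apply/forallP=> i.
have colT : fiber_perms col = [set 1%g].
  apply/setP=> q; rewrite in_set1; apply/fiber_permsP/eqP => [cq | ->] => [|i].
    by apply/permP=> i; rewrite perm1; apply/val_inj/cq.
  by rewrite perm1.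
have := sum_no_common_fix row col algC.
rewrite (transversal_sum_row cell_inj) // cardsT mulrA -exprMn mulrNN mul1r.
rewrite expr1n mul1r rowT colT => eqD; apply/eqP.
rewrite card_ord in eqD; rewrite -(eqr_nat algC) -eqD /nder -sum1_card natr_sum big_mkcond /=; apply/eqP.
apply: eq_big => [p|p _]; first by rewrite inE.
rewrite big_set1 odd_perm1 mul1r inE.
under [in RHS]eq_forallb do rewrite perm1 eqxx andbT.
by case: ifP.
Qed.

(** * Bounds *)

Section Bounds.

Local Open Scope nat_scope.

Lemma leq_dernumS k : 0 < k -> dernum k <= dernum k.+1.
Proof. by case: k => // k _; rewrite dernumSS; nia. Qed.

Lemma dernum_gt0 k : 0 < dernum k.+2.
Proof.
elim: k => // k IHk; apply: leq_trans IHk _; exact: leq_dernumS.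
Qed.

Lemma last_map_predn s : last 0 (map predn s) = (last 0 s).-1.
Proof. exact: (last_map predn s 0). Qed.

Lemma leq_last_sumn s : last 0 s <= sumn s.
Proof. by case/lastP: s => // s x; rewrite last_rcons sumn_rcons leq_addl. Qed.

Lemma dernum_le_abs_eta s : s != [::] -> dernum (last 0 s) <= abs_eta s.
Proof.
elim: s => // r [|r2 s] IHs _; first by rewrite abs_eta_row.
by rewrite abs_eta_rec // (leq_trans (IHs isT)) // leq_addr.
Qed.

(** Let k be the first row. A last row of length [r] contributes [r] times the value at a shape with
    first row k - 1, which [dernum_le_abs_eta] bounds below. *)
Lemma abs_eta_ge_hook s : s != [::] ->
  dernum (last 0 s) + (sumn s - last 0 s) * dernum (last 0 s).-1 <= abs_eta s.
Proof.
elim: s => // r [|r2 s] IHs _; first by rewrite abs_eta_row /= addn0 subnn addn0.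
rewrite abs_eta_rec //; set t := r2 :: s in IHs *.
have -> : last 0 (r :: t) = last 0 t by [].
have := @dernum_le_abs_eta (map predn (r :: t)) isT.
rewrite last_map_predn (_ : last 0 (r :: t) = last 0 t) // => le_pred.
rewrite [sumn (r :: t)]/= -/(sumn t) -addnBA ?leq_last_sumn // mulnDl addnCA addnC.
by rewrite leq_add ?IHs // leq_mul.
Qed.

Lemma abs_eta_cons0 s : s != [::] -> abs_eta (0 :: s) = abs_eta s.
Proof. by move=> s_n0; rewrite abs_eta_rec // mul0n addn0. Qed.

Lemma abs_eta_hook k m : abs_eta (rcons (nseq m 1) k) = dernum k + m * dernum k.-1.
Proof.
elim: m => [|m IHm]; first by rewrite abs_eta_row addn0.
have rc_n0 j x : rcons (nseq m j) x != [::] by case: m {IHm}.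
(* Without its first column the hook is a single row above empty rows. *)
have E0 x : abs_eta (0 :: rcons (nseq m 0) x) = dernum x.
  rewrite abs_eta_cons0 //; elim: m {IHm rc_n0} => [|m IHm]; first exact: abs_eta_row.
  by rewrite /= abs_eta_cons0 //; case: m IHm.
rewrite [rcons _ _]/= abs_eta_rec // IHm /= map_rcons map_nseq E0; lia.
Qed.

(* The value at the two-row shape (k, m) when m <= k. *)
Fixpoint two_row (k m : nat) : nat :=
  if m is m'.+1 then
    if k is k'.+1 then dernum k + m * two_row k' m' else 1
  else dernum k.

Lemma two_rowSS k m :
  two_row k.+1 m.+1 = dernum k.+1 + m.+1 * two_row k m.
Proof. by []. Qed.

Lemma leq_two_row k m1 m2 : m1 <= m2 -> two_row k m1 <= two_row k m2.
Proof.
elim: k m1 m2 => [|k IHk] [|m1] [|m2] //; first by move=> _; apply: leq_addr.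
by rewrite !two_rowSS ltnS leq_add2l => le_m; apply: leq_mul => //; apply: IHk.
Qed.

(** Expand with [two_rowSS]: the factors [m.+1 - r] and [r] add up to [m.+1], and [two_row] is
    monotone in its second argument. This absorbs a last row of length [r] into the second row. *)
Lemma two_row_rec_le k m r : r <= m.+1 ->
  two_row k.+1 (m.+1 - r) + r * two_row k m <= two_row k.+1 m.+1.
Proof.
move=> le_r; rewrite (two_rowSS k m); case def_j: (m.+1 - r) => [|j].
  by rewrite (_ : r = m.+1) //; lia.
rewrite two_rowSS -addnA leq_add2l.
have := leq_two_row k (_ : j <= m); nia.
Qed.

(* The value at the shape (k, k). *)
Definition two_row_sq k := dernum k + dernum k.+1.

Lemma two_row_diag k : two_row k k = two_row_sq k.
Proof.
by elim: k => // k IHk; rewrite two_rowSS IHk /two_row_sq dernumSS; lia.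
Qed.

Lemma two_row_sqS k : two_row_sq k.+1 = dernum k.+1 + k.+1 * two_row_sq k.
Proof. by rewrite /two_row_sq dernumSS; lia. Qed.

Lemma sorted_leq_last r s : sorted leq (r :: s) -> r <= last 0 (r :: s).
Proof.
move=> /= /(order_path_min leq_trans)/allP le_r.
by case/lastP: s le_r => // s x le_r; rewrite last_rcons le_r // mem_rcons mem_head.
Qed.

Lemma sorted_leq_sumn r s : sorted leq (r :: s) -> r * (size s).+1 <= sumn (r :: s).
Proof.
move=> /= /(order_path_min leq_trans)/allP le_r.
rewrite mulnS leq_add2l; elim: s le_r => [|x s IHs] le_r; first by rewrite muln0.
rewrite /= mulnS leq_add ?le_r ?mem_head // IHs // => y ys.
by rewrite le_r // inE ys orbT.
Qed.

Lemma sumn_map_predn s : 0 \notin s -> sumn (map predn s) + size s = sumn s.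
Proof.
elim: s => // r s IHs; rewrite inE negb_or => /andP[r_n0 /IHs] /=; lia.
Qed.

Lemma sorted_map_predn s : sorted leq s -> sorted leq (map predn s).
Proof. by apply: homo_sorted => x y; rewrite -!subn1; apply: leq_sub2r. Qed.

Lemma sorted_notin0 r s : 0 < r -> sorted leq (r :: s) -> 0 \notin r :: s.
Proof.
move=> r_gt0 /= /(order_path_min leq_trans)/allP le_r.
rewrite inE negb_or eq_sym -lt0n r_gt0; apply/negP => /le_r; lia.
Qed.

(* Here r is the length of the last row, t lists the other rows and u is the
   shape without its first column. *)
Lemma abs_eta_ind (P : seq nat -> Prop) :
    (forall k, P [:: k]) ->
    (forall t, t != [::] -> P t -> P (0 :: t)) ->
    (forall r t (u := map predn (r :: t)), 0 < r -> r <= last 0 t -> t != [::] ->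
       sorted leq (r :: t) -> sorted leq t -> sorted leq u -> u != [::] -> last 0 u = (last 0 t).-1 ->
       last 0 (r :: t) = last 0 t -> sumn (r :: t) = r + sumn t ->
       r * (size t).+1 <= sumn (r :: t) -> sumn u + (size t).+1 = r + sumn t ->
       abs_eta (r :: t) = abs_eta t + r * abs_eta u ->
       P t -> P u -> P (r :: t)) ->
  forall s, s != [::] -> sorted leq s -> P s.
Proof.
(* Removing a column lowers the sum; removing a row, even an empty one left by column removals,
   lowers the size. *)
move=> P1 P0 PS s; have [m le_m] := ubnP (sumn s + size s).
elim: m s le_m => // m IHm [|r [|r2 t]] //= le_m _ s_sorted.
set t' := r2 :: t; have t_sorted : sorted leq t' by case/andP: s_sorted.
have Pt : P t' by apply: IHm => //; rewrite /t' /=; lia.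
have [r0|r_gt0] := posnP r; first by rewrite r0; apply: P0.
have n0 := sorted_notin0 r_gt0 (s_sorted : sorted leq (r :: t')).
have sumE := sumn_map_predn n0.
have u_sorted := sorted_map_predn (s_sorted : sorted leq (r :: t')).
apply: PS => //.
- exact: (sorted_leq_last (s_sorted : sorted leq (r :: t'))).
- by rewrite last_map_predn.
- exact: (sorted_leq_sumn (s_sorted : sorted leq (r :: t'))).
- exact: abs_eta_rec.
by apply: IHm => //; move: sumE le_m; rewrite size_map /t' /=; lia.
Qed.

(** The hypothesis passes to the shape without its first column, whose first row is one shorter and
    which has lost at least two cells; [two_row_rec_le] then closes the induction. *)
Lemma abs_eta_le_two_row s : s != [::] -> sorted leq s ->
  sumn s <= (last 0 s).*2 -> abs_eta s <= two_row (last 0 s) (sumn s - last 0 s).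
Proof.
move=> s_n0 s_sorted; pattern s; apply: abs_eta_ind s_n0 s_sorted => {s}.
- by move=> k _; rewrite abs_eta_row /= addn0 subnn; case: k.
- move=> t t_n0 IHt; rewrite abs_eta_cons0 //; case: t t_n0 IHt.
move=> r t u r_gt0 le_r t_n0 rt_sorted t_sorted u_sorted u_n0 u_last -> -> le_sum u_sum -> IHt IHu.
move=> le_n; set k := last 0 t in le_r u_last IHt le_n *.
have le_k := leq_last_sumn t; rewrite -/k in le_k.
have k_gt0 : 0 < k by lia.
have size_t : 0 < size t by rewrite lt0n size_eq0.
have {}IHt : abs_eta t <= two_row k (sumn t - k) by apply: IHt; lia.
have {}IHu : abs_eta u <= two_row k.-1 (r + sumn t - k).-1.
  apply: leq_trans (IHu _) _; rewrite u_last; first lia.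
  by apply: leq_two_row; lia.
have := @two_row_rec_le k.-1 (r + sumn t - k).-1 r; rewrite !prednK; try lia.
have -> : r + sumn t - k - r = sumn t - k by lia.
nia.
Qed.

Lemma abs_eta_le_diag s : s != [::] -> sorted leq s ->
  sumn s <= (last 0 s).*2 -> abs_eta s <= two_row_sq (last 0 s).
Proof.
move=> s_n0 s_sorted le_n; apply: leq_trans (abs_eta_le_two_row s_n0 s_sorted le_n) _.
by rewrite -two_row_diag; apply: leq_two_row; lia.
Qed.

(** The bound is the value at (k, k, 1), where k is the first row. There are at least three rows, so
    removing the first column costs at least three cells, and both smaller shapes fall under the
    earlier bounds. *)
Lemma abs_eta_le_diagS s : s != [::] -> sorted leq s ->
  sumn s = (last 0 s).*2.+1 ->
  abs_eta s <= two_row_sq (last 0 s) + two_row_sq (last 0 s).-1.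
Proof.
move=> s_n0 s_sorted; pattern s; apply: abs_eta_ind s_n0 s_sorted => {s}.
- by move=> k /=; lia.
- move=> t t_n0 IHt; rewrite abs_eta_cons0 //; case: t t_n0 IHt.
move=> r t u r_gt0 le_r t_n0 rt_sorted t_sorted u_sorted u_n0 u_last -> -> le_sum u_sum -> _ _.
move=> def_n; set k := last 0 t in le_r u_last def_n *.
(* With only two rows, the second would have k + 1 cells. *)
have size_t : 1 < size t.
  case: (t) (t_n0) (erefl : k = last 0 t) def_n => [|x [|y t']] //= _ def_k; lia.
have le_t : abs_eta t <= two_row k (sumn t - k).
  by apply: abs_eta_le_two_row; rewrite // -/k; lia.
have le_u : abs_eta u <= two_row_sq k.-1.
  by rewrite -u_last; apply: abs_eta_le_diag; rewrite // u_last; lia.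
(* One of the [r] copies of the value at [u] is covered by the second term of the bound; the second
   row absorbs the other [r.-1]. *)
have := @two_row_rec_le k.-1 k.-1 r.-1; rewrite !prednK; try lia.
have -> : k - r.-1 = sumn t - k by lia.
rewrite !two_row_diag; nia.
Qed.

(* The value at the shape (h, h) or (h, h, 1) with n cells. *)
Definition near_square n :=
  two_row_sq n./2 + (if n./2 is h.+1 then odd n * two_row_sq h else 0).

Lemma near_square_double h : near_square h.*2 = two_row_sq h.
Proof. by rewrite /near_square doubleK odd_double; case: h => //= h; rewrite addn0. Qed.

Lemma near_squareS_double h :
  near_square h.*2.+1 = two_row_sq h + (if h is h'.+1 then two_row_sq h' else 0).
Proof. by rewrite /near_square -uphalfE uphalf_double /= odd_double; case: h => //= h; rewrite mul1n. Qed.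

Lemma leq_two_row_sqS h : h.+1 * two_row_sq h <= two_row_sq h.+1.
Proof. by rewrite two_row_sqS leq_addl. Qed.

Lemma leq_near_squareS n : near_square n <= near_square n.+1.
Proof.
rewrite -(odd_double_half n); case: (odd n); rewrite ?add1n ?add0n.
  rewrite -doubleS near_squareS_double near_square_double.
  case: n./2 => // h; have := leq_two_row_sqS h; have := leq_two_row_sqS h.+1; nia.
by rewrite near_squareS_double near_square_double leq_addr.
Qed.

Lemma leq_near_square m n : m <= n -> near_square m <= near_square n.
Proof. exact: (homo_leq leqnn leq_trans leq_near_squareS). Qed.

Lemma near_square_rec_even h r : r <= h.+1 ->
  near_square h.*2.+3 + r * near_square h.*2.+1 <= near_square h.+2.*2.
Proof.
move=> le_r; rewrite -[h.*2.+3]/(h.+1.*2.+1) !near_squareS_double near_square_double.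
case: h le_r => [|[|h]] le_r; try by rewrite /two_row_sq /=; lia.
have := leq_two_row_sqS h.+1; have := leq_two_row_sqS h.+2.
have := leq_two_row_sqS h.+3.
move: (two_row_sq h.+1) (two_row_sq h.+2) (two_row_sq h.+3) (two_row_sq h.+4).
move=> x y z w wz zy yx; have : r * (y + x) <= h.+3 * (y + x) by rewrite leq_mul2r le_r orbT.
nia.
Qed.

(** Here [x] bounds the number of cells of the shape without its last row, and [n - 3] that of the
    shape without its first column. *)
Lemma near_square_rec n x r : r.*2.+2 <= n -> 0 < r -> x < n ->
    (1 < r -> x.+1 < n) ->
  near_square x + r * near_square (n - 3) <= near_square n.
Proof.
move=> le_r r_gt0 lt_x lt_x'.
have := odd_double_half n; case: (odd n); rewrite ?add1n ?add0n.
  case: n./2 => [|h] def_n; first lia.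
  rewrite (_ : n - 3 = h.*2); last by lia.
  rewrite near_square_double -def_n near_squareS_double.
  (* For odd [n], [r = 1] and [x = n - 1] both sides are equal; a longer last row relies on the
     stronger bound for [x]. *)
  have [r1|r_gt1] := leqP r 1.
    have -> : r = 1 by lia.
    rewrite mul1n leq_add2r -near_square_double; apply: leq_near_square; lia.
  apply: (@leq_trans (near_square h.*2.+1 + r * two_row_sq h)).
    by rewrite leq_add2r; apply: leq_near_square; lia.
  rewrite near_squareS_double two_row_sqS.
  have le_rh : r <= h by lia.
  case: h def_n le_rh => [|h] def_n le_rh; first lia.
  have := leq_two_row_sqS h; rewrite /two_row_sq; nia.
case: n./2 => [|[|h]] def_n; try lia.
rewrite (_ : n - 3 = h.*2.+1); last by lia.
apply: leq_trans (_ : near_square h.*2.+3 + r * near_square h.*2.+1 <= _).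
  by rewrite leq_add2r; apply: leq_near_square; lia.
by rewrite -def_n; apply: near_square_rec_even; lia.
Qed.

(** Up to 2k + 1 cells, k being the first row, the bounds above apply. Beyond that there are at
    least three rows, so removing the first column costs at least three cells, and [near_square_rec]
    gives the induction step. *)
Lemma abs_eta_le_near_square s : s != [::] -> sorted leq s ->
  (last 0 s).*2 <= sumn s -> abs_eta s <= near_square (sumn s).
Proof.
move=> s_n0 s_sorted; pattern s; apply: abs_eta_ind s_n0 s_sorted => {s}.
- by move=> k /=; rewrite addn0 abs_eta_row => le_k; have -> : k = 0 by lia.
- move=> t t_n0 IHt; rewrite abs_eta_cons0 //; case: t t_n0 IHt.
move=> r t u r_gt0 le_r t_n0 rt_sorted t_sorted u_sorted u_n0 u_last last_rt sum_rt le_sum u_sum eq_eta.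
move=> IHt IHu le_n; set k := last 0 t in le_r u_last IHt last_rt.
have rt_n0 : r :: t != [::] by [].
have [le_n2 | lt_n] := leqP (sumn (r :: t)) k.*2.
  rewrite (_ : sumn (r :: t) = k.*2); last by rewrite last_rt in le_n; lia.
  by rewrite near_square_double -last_rt; apply: abs_eta_le_diag; rewrite // last_rt.
have [le_n3 | {}lt_n] := leqP (sumn (r :: t)) k.*2.+1.
  have def_n : sumn (r :: t) = k.*2.+1 by lia.
  have := abs_eta_le_diagS rt_n0 rt_sorted; rewrite last_rt => /(_ def_n).
  rewrite def_n near_squareS_double; case: (k) lt_n le_r => // le_r; lia.
have size_t : 1 < size t.
  case: (t) (t_n0) (erefl : k = last 0 t) lt_n le_r => [|x [|y t']] //= _ def_k; lia.
rewrite eq_eta.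
(* [t] may have fewer than 2k cells; then the bound by the shape (k, k) replaces the induction
   hypothesis. *)
have le_t : abs_eta t <= near_square (maxn (sumn t) k.*2).
  have [le_kt | /ltnW lt_tk] := leqP k.*2 (sumn t); first exact: IHt.
  by rewrite near_square_double; apply: abs_eta_le_diag.
have le_u : abs_eta u <= near_square (sumn (r :: t) - 3).
  have [le_ku | /ltnW lt_uk] := leqP (last 0 u).*2 (sumn u).
    by apply: leq_trans (IHu le_ku) _; apply: leq_near_square; lia.
  apply: leq_trans (abs_eta_le_diag u_n0 u_sorted lt_uk) _.
  by rewrite -near_square_double; apply: leq_near_square; lia.
apply: leq_trans (near_square_rec (x := maxn (sumn t) k.*2) _ r_gt0 _ _); try lia.
by apply: leq_add => //; apply: leq_mul.
Qed.

(** The right side is the value at the hook with as many cells and first row [k.+1]. For [m] at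
    least 2 even the value at (k, k) is small enough, by [two_row_diag]. *)
Lemma two_row_le_hook k m : (0 < m <= k) ->
  (two_row k m <= dernum k.+1 + m.-1 * dernum k).
Proof.
case: k => [|k]; first by lia.
case: m => [//|[|m]] le_mk.
  have -> : two_row k.+1 1 = (dernum k.+1 + dernum k).
    by rewrite two_rowSS mul1n; case: (k).
  by rewrite dernumSS addn0 leq_pmull.
apply: (leq_trans (leq_two_row k.+1 (_ : m.+2 <= k.+1))); first lia.
by rewrite two_row_diag /two_row_sq; nia.
Qed.

(** After cancelling [dernum h.+1], D_h is compared with (h - 1) D_h for even [n], and 2 D_h +
    D_{h-1} with h D_h for odd [n]. There is equality at 4 and 5, and the bound fails at 3. *)
Lemma near_square_le_hook n (h := n./2) : (4 <= n) ->
  (near_square n <= dernum h.+1 + (n - h.+1) * dernum h)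
  /\ ((6 <= n) -> (near_square n < dernum h.+1 + (n - h.+1) * dernum h)).
Proof.
move=> n_ge4; rewrite {}/h; have := odd_double_half n.
case: (odd n); rewrite ?add1n ?add0n; case: n./2 => [|[|h]] def_n; try lia.
  have -> : (n - h.+3 = h.+2) by lia.
  rewrite -{1 3}def_n near_squareS_double /two_row_sq.
  case: h def_n => [|h] def_n; first by split=> //; lia.
  have D3 := dernumSS h.+1; have := dernum_gt0 h.
  by split=> [|_]; nia.
have -> : (n - h.+3 = h.+1) by lia.
rewrite -{1 3}def_n near_square_double /two_row_sq.
by have := dernum_gt0 h; move: (dernum h.+2) (dernum h.+3) => x y; split=> [|n_ge6]; nia.
Qed.

(** The last hypothesis excludes k = 1 with three cells, that is (1, 1, 1), where the value 2
    exceeds the bound 1. *)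
Lemma abs_eta_le_hook s (k := last 0 s) : s != [::] -> sorted leq s ->
    (0 < k < sumn s) -> (sumn s <= k.*2.+1) -> (1 < k) || (sumn s != 3) ->
  (abs_eta s <= dernum k.+1 + (sumn s - k.+1) * dernum k).
Proof.
move=> s_n0 s_sorted /andP[k_gt0 lt_k] le_n n_ne3; rewrite subnS.
have [le_n2 | lt_n2] := leqP (sumn s) k.*2.
  apply: leq_trans (abs_eta_le_two_row s_n0 s_sorted le_n2) _.
  by apply: two_row_le_hook; lia.
have def_n : sumn s = k.*2.+1 by lia.
apply: leq_trans (abs_eta_le_diagS s_n0 s_sorted def_n) _; rewrite -/k def_n.
have -> : ((k.*2.+1 - k).-1 = k) by lia.
rewrite def_n in n_ne3; rewrite /two_row_sq.
case: (k) k_gt0 n_ne3 => [|[|[|k']]] //= _ _.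
by have := leq_dernumS (ltn0Sn k'.+1); nia.
Qed.

End Bounds.

(** * The eigenvalue *)

(* The eigenspace of a class sum is a submodule, so a class sum acts as a
   scalar on the cyclic module spanned by one of its eigenvectors. *)
Lemma cyclic_class_sum_char (gT : finGroupType) (G : {group gT}) (m : nat)
    (rG : mx_representation algC G m) (u : 'rV_m) (D : {set gT}) (e : algC) :
    D \subset G -> G \subset 'N(D)%g -> u != 0 ->
    u *m (\sum_(s in D) rG s) = e *: u ->
  (cfRepr (submod_repr (cyclic_mx_module rG u)) 1%g)^-1 *
    \sum_(s in D) cfRepr (submod_repr (cyclic_mx_module rG u)) s = e.
Proof.
move=> sDG nDG nz_u uZ; set Z := \sum_(s in D) rG s in uZ.
have Zcent g : g \in G -> rG g *m Z = Z *m rG g.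
  move=> Gg; rewrite mulmx_sumr mulmx_suml (reindex_inj (conjg_inj g)) /=.
  apply: eq_big => [s | s Ds]; first by rewrite memJ_norm ?(subsetP nDG).
  rewrite memJ_norm ?(subsetP nDG) // in Ds.
  have Gs := subsetP sDG s Ds.
  by rewrite -!repr_mxM ?groupJ // -conjgC.
set U := cyclic_mx rG u; set rU := submod_repr _.
have sUK : (U <= kermx (Z - e%:M))%MS.
  apply: cyclic_mx_sub; last first.
    by apply/sub_kermxP; rewrite mulmxBr uZ mul_mx_scalar subrr.
  apply/mxmoduleP=> g Gg; apply/sub_kermxP.
  by rewrite -mulmxA mulmxBr Zcent // mul_mx_scalar -mul_scalar_mx -mulmxBl mulmxA mulmx_ker mul0mx.
have sumU : \sum_(s in D) rU s = e%:M.
  apply: val_submod_inj; rewrite linear_sum.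
  transitivity (val_submod (1%:M : 'M_(\rank U)) *m Z).
    rewrite mulmx_sumr; apply: eq_bigr => s Ds.
    by rewrite -[rU s]mul1mx; apply: val_submodJ; apply: (subsetP sDG).
  have /sub_kermxP/eqP : (val_submod (1%:M : 'M_(\rank U)) <= kermx (Z - e%:M))%MS.
    exact: submx_trans (val_submodP _) sUK.
  rewrite mulmxBr subr_eq0 => /eqP->.
  by rewrite mul_mx_scalar -[in RHS](scalemx1 _ e) linearZ.
have nzU : (\rank U)%:R != 0 :> algC by rewrite pnatr_eq0 mxrank_eq0 cyclic_mx_eq0.
rewrite cfRepr1 (eq_bigr (fun s => \tr (rU s))) => [|s Ds].
  by rewrite -linear_sum /= sumU mxtrace_scalar -[e *+ _]mulr_natl mulKf.
by rewrite cfunE (subsetP sDG) ?mulr1n.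
Qed.

(** * The Young symmetrizer as an eigenvector of the sum of derangements *)

Section SpechtEigenvalue.

Variables (n : nat) (la : seq nat).
Hypotheses (la_sorted : sorted geq la) (la_n : sumn la = n).

Local Notation row := (fun i : 'I_n => reshape_index la i).
Local Notation col := (fun i : 'I_n => reshape_offset la i).

Lemma cell_inj (i j : 'I_n) : row i = row j -> col i = col j -> i = j.
Proof.
move=> rij cij; apply: val_inj.
by rewrite /= -(reshape_indexK la i) -(reshape_indexK la j) rij cij.
Qed.

Lemma row_lt (i : 'I_n) : (row i < size la)%N.
Proof. by rewrite reshape_indexP // la_n. Qed.

Lemma col_lt (i : 'I_n) : (col i < nth 0%N la (row i))%N.
Proof. by rewrite reshape_offsetP // la_n. Qed.

Lemma cell_ex r c : (c < nth 0 la r)%N -> exists i : 'I_n, row i = r /\ col i = c.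
Proof.
move=> lt_c; have lt_n : (flatten_index la r c < n)%N.
  by rewrite -la_n flatten_indexP.
by exists (Ordinal lt_n); rewrite /= flatten_indexKl ?flatten_indexKr.
Qed.

Lemma card_row_cells b : row_length row [set: 'I_n] b = nth 0%N la b.
Proof.
have lt_n (c : 'I_(nth 0%N la b)) : (flatten_index la b c < n)%N.
  by rewrite -la_n flatten_indexP.
have f_inj : injective (fun c => Ordinal (lt_n c)).
  by move=> c d /(congr1 val) /= /addnI; apply: val_inj.
rewrite -[RHS]card_ord -(card_imset _ f_inj); congr #|pred_of_set _|.
apply/setP=> i; rewrite !inE; apply/eqP/imsetP => [ri | [c _ ->] /=].
  have lt_c : (col i < nth 0%N la b)%N by rewrite -ri; apply: col_lt.
  exists (Ordinal lt_c); rewrite ?inE //; apply: val_inj => /=.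
  by rewrite -ri reshape_indexK.
by rewrite flatten_indexKl.
Qed.

Local Notation S_n := [set: 'S_n].
Local Notation vec x := (gring_row (regular_repr algC S_n x)).
Local Notation D := (derangements n).
Local Notation N := (signed_count row col algC D).

Lemma derangementsJ (s t : 'S_n) : (s ^ t \in D)%g = (s \in D).
Proof.
rewrite !inE; apply/forallP/forallP=> H i.
  by have := H (t i); rewrite permJ (inj_eq perm_inj).
by rewrite -(permKV t i) permJ (inj_eq perm_inj).
Qed.

(** By von Neumann's lemma [N] vanishes off the products [p * q]; on these the factorisation is
    unique by [rowst_colst1], and [signed_countMl] and [signed_countMr] give the value. *)
Lemma signed_count_young (x : 'S_n) :
  N x = \sum_(p in fiber_perms row) \sum_(q in fiber_perms col)
          (-1) ^+ odd_perm q * N 1%g * (x == (p * q)%g)%:R.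
Proof.
have [/exists_inP[p Rp Cq] | notRC] :=
    boolP [exists p in fiber_perms row, p^-1 * x \in fiber_perms col]%g.
  rewrite (bigD1 p) //= (bigD1 (p^-1 * x)%g) //= mulKVg eqxx mulr1.
  rewrite [X in _ + X + _]big1 ?addr0 => [|q /andP[_ /eqP ne_q]]; last first.
    case: eqP => [eq_x|_]; rewrite ?mulr0 //.
    by case: ne_q; rewrite eq_x mulKg.
  rewrite big1 ?addr0 => [|r /andP[Rr /eqP ne_r]]; last first.
    rewrite big1 // => q Cq'; case: eqP => [eq_x|_]; rewrite ?mulr0 //.
    case: ne_r; apply/eqP; rewrite eq_sym eq_mulVg1; apply/eqP.
    apply: (rowst_colst1 cell_inj); first by rewrite groupM ?groupV.
    have -> : (p^-1 * r = (p^-1 * x) * q^-1)%g by rewrite eq_x !mulgA mulgK.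
    by rewrite groupM ?groupV.
  rewrite -{1}(mulKVg p x) signed_countMl // -{1}(mul1g (p^-1 * x)%g).
  by rewrite signed_countMr.
rewrite (signed_count_eq0 row_lt col_lt cell_ex _ _ notRC).
rewrite big1 // => p Rp; rewrite big1 // => q Cq.
case: eqP => [eq_x|_]; rewrite ?mulr0 //; case/existsP: notRC; exists p.
by rewrite Rp eq_x mulKg.
Qed.

Lemma young_sym_class_sum :
  young_sym n la *m (\sum_(s in D) regular_repr algC S_n s) = N 1%g *: young_sym n la.
Proof.
transitivity (\sum_x N x *: vec x).
  rewrite /young_sym mulmx_suml.
  under [RHS]eq_bigr => x _ do rewrite /signed_count scaler_suml.
  rewrite exchange_big [RHS](reindex_inj invg_inj) /=.
  apply: eq_big => [p | p _]; first by rewrite groupV.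
  under [RHS]eq_bigr => x _ do rewrite scaler_suml.
  rewrite mulmx_suml exchange_big [RHS](reindex_inj invg_inj) /=.
  apply: eq_big => [q | q _]; first by rewrite groupV.
  rewrite -scalemxAl mulmx_sumr scaler_sumr odd_permV.
  (* With [p] and [q] inverted, the substitution [x = p * q * s] turns the argument of [D] into a
     conjugate of [s]. *)
  rewrite [RHS](reindex_inj (mulgI (p * q)%g)) [LHS]big_mkcond /=.
  apply: eq_bigr => s _.
  rewrite -gring_row_mul -repr_mxM ?in_setT //.
  have -> : (p^-1 * (p * q * s) * q^-1 = s ^ q^-1)%g.
    by rewrite conjgE invgK !mulgA mulVg mul1g.
  by rewrite derangementsJ; case: ifP; rewrite ?mulr1 // mulr0 scale0r.
under eq_bigr => x _ do rewrite signed_count_young scaler_suml.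
rewrite exchange_big /young_sym scaler_sumr; apply: eq_bigr => p _ /=.
under eq_bigr => x _ do rewrite scaler_suml.
rewrite exchange_big scaler_sumr; apply: eq_bigr => q _ /=.
rewrite (bigD1 (p * q)%g) //= eqxx mulr1 big1 ?addr0 => [|x /negPf->].
  by rewrite scalerA mulrC.
by rewrite mulr0 scale0r.
Qed.

(** Only [p = q = 1] gives [p * q = 1], so the identity has coefficient 1. *)
Lemma young_sym_neq0 : young_sym n la != 0.
Proof.
apply/eqP => /rowP/(_ (gring_index S_n 1%g)); rewrite mxE /young_sym summxE.
rewrite (bigD1 _ (group1 (fiber_perms_group row))) summxE /=.
rewrite (bigD1 _ (group1 (fiber_perms_group col))) /=.
have coef (x : 'S_n) : vec x 0 (gring_index S_n 1%g) = (x == 1%g)%:R.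
  rewrite /gring_row /= mxE mxE gring_indexK ?inE // mul1g !mxE eqxx /=.
  by rewrite (can_in_eq (@gring_indexK _ _)) ?inE // eq_sym.
have scE (a : algC) (v : 'rV_#|S_n|) i : (a *: v) 0 i = a * v 0 i by rewrite mxE.
rewrite scE coef mulg1 eqxx odd_perm1 mulr1.
rewrite [X in _ + X + _]big1 => [|q /andP[Cq ne_q]]; last first.
  by rewrite scE coef mul1g (negPf ne_q) mulr0.
rewrite [X in _ + X]big1 => [|p /andP[Rp ne_p]]; last first.
  rewrite summxE big1 // => q Cq; rewrite scE coef.
  case: eqP => [/eqP|_]; rewrite ?mulr0 // -eq_invg_mul => /eqP pq.
  case/eqP: ne_p; apply: (rowst_colst1 cell_inj) => //.
  by rewrite -groupV pq.
by rewrite !addr0 => /eqP; rewrite oner_eq0.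
Qed.

Lemma eta_signed_count : eta n la = N 1%g.
Proof.
apply: cyclic_class_sum_char.
- exact: subsetT.
- apply/subsetP=> t _; rewrite inE; apply/subsetP=> _ /imsetP[s Ds ->].
  by rewrite derangementsJ.
- exact: young_sym_neq0.
exact: young_sym_class_sum.
Qed.

Lemma norm_eta : (0 < size la)%N -> `|eta n la| = (abs_eta (rev la))%:R.
Proof.
move=> la_gt0; rewrite eta_signed_count.
have -> : N 1%g = (-1) ^+ #|'I_n| * transversal_sum row col algC setT.
  rewrite -sum_no_common_fix; apply: eq_bigr => p Rp; apply: eq_bigr => q Cq.
  by rewrite mulg1 -(fixfree_mul cell_inj) // in_set.
rewrite (transversal_sumE cell_inj algC (a := (size la).-1)).
- rewrite prednK // !normrM !normrX normrN1 !expr1n !mul1r normr_nat.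
  congr (abs_eta _)%:R; rewrite /row_lengths map_rev; congr rev.
  rewrite -[RHS](mkseq_nth 0%N); apply/eq_in_map => b; rewrite mem_iota /= add0n => lt_b.
  by rewrite card_row_cells.
- move=> i b _ le_b.
  have [j [rj cj]] : exists j : 'I_n, row j = b /\ col j = col i.
    apply: cell_ex; apply: leq_trans (col_lt i) _.
    have geq_trans : transitive geq by move=> x y z xy /leq_trans; apply.
    apply: (sorted_leq_nth geq_trans leqnn 0%N la_sorted) => //.
      exact: leq_ltn_trans le_b (row_lt i).
    exact: row_lt.
  by exists j; rewrite rj cj inE.
by move=> i _; rewrite -ltnS prednK // row_lt.
Qed.

End SpechtEigenvalue.

(** * Hooks, and the comparison of eigenvalues *)

Lemma hook_intpart k m : (0 < k)%N -> is_intpart (k + m) (hook k m).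
Proof.
case: k => // k _; rewrite /is_intpart /= sumn_nseq mul1n eqxx andbT inE /=.
rewrite (mem_nseq m 1%N) andbF andbT; case: m => //= m.
by elim: m => //= m ->.
Qed.

Lemma norm_eta_intpart n la : (0 < n)%N -> is_intpart n la ->
  `|eta n la| = (abs_eta (rev la))%:R.
Proof.
move=> n_gt0 /and3P[la_sorted _ /eqP la_n]; apply: norm_eta => //.
by case: la la_n {la_sorted} n_gt0 => // <-.
Qed.

Lemma norm_eta_hook n k : (1 <= k <= n)%N ->
  `|eta n (hook k (n - k))| = (dernum k + (n - k) * dernum k.-1)%:R.
Proof.
move=> /andP[k_gt0 le_kn]; rewrite norm_eta_intpart; last 1 first.
- by rewrite -{1}(subnKC le_kn) hook_intpart.
- by rewrite rev_cons rev_nseq abs_eta_hook.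
exact: leq_trans le_kn.
Qed.

(* The upper bound in the first part fails for the single partition (1,1,1):
   there |eta_(1,1,1)| = 2 while |eta_(2,1)| = 1; hence its exclusion. *)
Theorem theorem1p3 (n : nat) (la : seq nat)
    (n_gt0 : (1 <= n)%N) (la_n : is_intpart n la) :
  [/\ (n./2 <= head 0%N la)%N ->
        `|eta n (hook (head 0%N la) (n - head 0%N la))| <= `|eta n la|
        /\ ((head 0%N la <= n - 1)%N -> la <> [:: 1; 1; 1]%N ->
            `|eta n la| <=
              `|eta n (hook (head 0%N la + 1) (n - head 0%N la - 1))|),
      (head 0%N la < n./2)%N ->
        `|eta n la| <= `|eta n (hook (n./2 + 1) (n - n./2 - 1))|
        /\ ((6 <= n)%N ->
            `|eta n la| < `|eta n (hook (n./2 + 1) (n - n./2 - 1))|)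
    & forall k : nat, (1 <= k <= n)%N ->
        `|eta n (hook k (n - k))| = (nder k + (n - k) * nder (k - 1))%:R].
Proof.
rewrite (norm_eta_intpart n_gt0 la_n); set s := rev la; set k := head 0%N la.
have /and3P[la_sorted la_n0 /eqP sum_la] := la_n.
have last_s : last 0%N s = k.
  by rewrite /s /k; case: (la) => // x l; rewrite rev_cons last_rcons.
have sum_s : sumn s = n by rewrite sumn_rev.
have s_sorted : sorted leq s by rewrite rev_sorted.
have s_n0 : s != [::] by case: (s) sum_s => // sum0; rewrite -sum0 in n_gt0.
have k_gt0 : (0 < k)%N.
  rewrite lt0n; apply: contraNneq la_n0 => k0; rewrite -k0 /k.
  by case: (la) sum_la n_gt0 => [<-|x l _ _] //; rewrite mem_head.
have le_kn : (k <= n)%N by rewrite -sum_s -last_s leq_last_sumn.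
split.
- move=> le_hk; split.
    rewrite norm_eta_hook ?k_gt0 // ler_nat -sum_s -last_s.
    exact: abs_eta_ge_hook.
  move=> lt_kn la_ne; rewrite -subnDA norm_eta_hook; last lia.
  rewrite ler_nat addn1 -sum_s -last_s.
  apply: abs_eta_le_hook; rewrite // ?last_s ?sum_s; try lia.
  (* With k = 1 and n = 3 every part is 1, so [la] is the excluded partition. *)
  have [//|k_le1] := ltnP 1 k; apply/eqP=> n3; case: la_ne.
  have k1 : k = 1%N by lia.
  have all1 : all (pred1 1%N) la.
    apply/allP=> x x_la /=; have x_gt0 : (0 < x)%N.
      by rewrite lt0n; apply: contraNneq la_n0 => <-.
    have le_x : (x <= k)%N.
      rewrite /k; case: (la) la_sorted x_la => //= y l.
      move/(order_path_min (rev_trans leq_trans))/allP=> le_y.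
      by rewrite inE => /predU1P[->|/le_y].
    by rewrite eqn_leq x_gt0 -k1 le_x.
  by have /all_pred1P eq_la := all1; move: sum_la; rewrite eq_la sumn_nseq mul1n n3 => ->.
- move=> lt_kh; rewrite -subnDA norm_eta_hook; last lia.
  rewrite addn1 ler_nat ltr_nat.
  have le_s : (abs_eta s <= near_square n)%N.
    by rewrite -sum_s; apply: abs_eta_le_near_square; rewrite // last_s sum_s; lia.
  (* Since 0 < k < [n./2], the half is at least 2. *)
  have n_ge4 : (4 <= n)%N by lia.
  have [le_B lt_B] := near_square_le_hook n_ge4.
  by split=> [|n_ge6]; [apply: leq_trans le_B | apply: leq_ltn_trans (lt_B n_ge6)].
by move=> j /norm_eta_hook->; rewrite !nderE subn1.
Qed.
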